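(* Let $n \geq 1$ be an integer. For $\mathbf{p} = (p_1,\ldots,p_n) \in [0,1]^n$ let $X_1,\ldots,X_n$ be independent random variables with $X_i$ Bernoulli of parameter $p_i$, let $S = \sum_{i=1}^n X_i$, and let $f_k = \mathbb{P}(S=k)$ for $k \in \{0,\ldots,n\}$. Let $$H(\mathbf{p}) = -\sum_{k=0}^n f_k \log(f_k)$$ be the Shannon entropy of $S$. Then the function $\mathbf{p} \mapsto H(\mathbf{p})$ is concave on $[0,1]^n$.
   Context: The convention $0 \log 0 := 0$ is used. A Bernoulli variable of parameter $p$ takes the value $1$ with probability $p$ and $0$ with probability $1-p$. *)

(* Defs.v *)
From HB Require Import structures.
From mathcomp Require Import all_boot all_order all_algebra.
From mathcomp Require Import interval_inference.
From mathcomp Require Import all_classical all_reals all_analysis.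
From mathcomp Require Import measurable_realfun.

Set Implicit Arguments.
Unset Strict Implicit.
Unset Printing Implicit Defensive.

Import Order.TTheory GRing.Theory Num.Theory.
Import numFieldNormedType.Exports.

Local Open Scope classical_set_scope.
Local Open Scope ring_scope.
Local Open Scope convex_scope.

(* Mirrors [convex_function], with the inequality reversed. *)
Definition concave_function (R : numFieldType) (E : lmodType R)
    (E' := convex_lmodType E) (D : set E') (f : E' -> R^o) : Prop :=
  forall t : {i01 R},
    {in D &, forall x y : E', (f x <| t |> f y <= f (x <| t |> y))%R}.

Definition unit_cube (R : numDomainType) (n : nat) : set 'rV[R]_n :=
  [set p | forall i, 0 <= p ord0 i <= 1].

Arguments unit_cube R n : clear implicits.

Section random_variables.
Context (R : realType) (d : measure_display) (T : measurableType d).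
Context (P : probability T R).

Definition bernoulli_RV (X : {RV P >-> R}) (p : R) : Prop :=
  P (X @^-1` [set 1]) = p%:E /\ P (X @^-1` [set 0]) = (1 - p)%:E.

Definition independent_RVs (I : finType) (X : I -> {RV P >-> R}) : Prop :=
  forall (J : {set I}) (B : I -> set R),
    (forall i, i \in J -> measurable (B i)) ->
    P (\bigcap_(i in [set` J]) (X i @^-1` B i)) =
    (\prod_(i in J) P (X i @^-1` B i))%E.

Definition sum_RV (n : nat) (X : 'I_n -> {RV P >-> R}) : {RV P >-> R} :=
  (\sum_(i < n) (X i : {mfun T >-> R}) : {mfun T >-> R}).

Lemma sum_RVE (n : nat) (X : 'I_n -> {RV P >-> R}) (w : T) :
  sum_RV X w = \sum_(i < n) X i w.
Proof. by rewrite /sum_RV /= mfun_sum. Qed.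

(* Meant for [S] with values in {0, ..., n}; the convention 0 * log 0 = 0 holds
   because [ln 0] is a real number. *)
Definition shannon_entropy (n : nat) (S : {RV P >-> R}) : R :=
  - \sum_(k < n.+1) pmf S k%:R * ln (pmf S k%:R).

End random_variables.

(* Main.v *)
(* Along a segment with direction v, let f be the mass function of S and f^(i),
   f^(i,j) those of S without X_i, resp. without X_i and X_j. With
   g = \sum_i v_i f^(i) and h = \sum_(i <> j) v_i v_j f^(i,j), the generating
   functions satisfy f' = (X - 1) g and f'' = (X - 1)^2 h. The heart of the
   proof is the inequality (lemma [glc])
     h_k (f_{k+1}^2 - f_k f_{k+2})
       <= 2 g_k g_{k+1} f_{k+1} - g_k^2 f_{k+2} - g_{k+1}^2 f_k.
   Its two sides differ by a quadratic form in v whose off-diagonal coefficients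
   are -p_i (1 - p_i) p_j (1 - p_j) times a 3x3 Toeplitz minor of f^(i,j), hence
   nonpositive by total positivity, and whose matrix sends the positive vector p
   to a vector with entries f_{k+2} p_i ((f^(i)_k)^2 - f^(i)_{k-1} f^(i)_{k+1}),
   nonnegative by log-concavity. Such a form is positive semidefinite. Together
   with 2 ln z <= z - 1/z for z >= 1, the inequality bounds each term of the
   second derivative of the entropy after summation by parts. This gives
   concavity in the open cube; the boundary is reached by continuity. *)
Require Import Defs.
From mathcomp Require Import all_boot all_order all_algebra.
From mathcomp Require Import all_classical all_reals all_analysis.
From mathcomp Require Import zify ring lra.

Set Implicit Arguments.
Unset Strict Implicit.
Unset Printing Implicit Defensive.

Import Order.TTheory GRing.Theory Num.Theory.
Import numFieldNormedType.Exports.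

Local Open Scope classical_set_scope.
Local Open Scope ring_scope.

(** * Derivatives of products of polynomials *)

Lemma deriv_prod_seq (R : comNzRingType) (I : eqType) (r : seq I) (A : pred I)
    (F : I -> {poly R}) : uniq r ->
  (\prod_(i <- r | A i) F i)^`() =
  \sum_(i <- r | A i) (F i)^`() * \prod_(j <- r | A j && (j != i)) F j.
Proof.
elim: r => [|x r IH] /=; first by rewrite !big_nil derivC.
case/andP=> xr /IH {}IH; rewrite !big_cons.
have E : \prod_(j <- r | A j && (j != x)) F j = \prod_(j <- r | A j) F j.
  rewrite big_seq_cond [RHS]big_seq_cond; apply: eq_bigl => j.
  by case: eqP => [->|]; rewrite ?(negPf xr) ?andbT.
have E2 : \sum_(i <- r | A i)
      (F i)^`() * \prod_(j <- x :: r | A j && (j != i)) F j =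
    (if A x then F x else 1) *
    \sum_(i <- r | A i) (F i)^`() * \prod_(j <- r | A j && (j != i)) F j.
  rewrite mulr_sumr big_seq_cond [RHS]big_seq_cond.
  apply: eq_bigr => i /andP[ir _].
  rewrite big_cons; have -> : x != i by apply: contraNneq xr => ->.
  by case: (A x); rewrite andbT ?mul1r // mulrCA.
case Ax: (A x) in E2 *; last by rewrite IH E2 mul1r.
by rewrite derivM IH E2 eqxx E.
Qed.

Lemma deriv_prod (R : comNzRingType) (I : finType) (A : pred I)
    (F : I -> {poly R}) :
  (\prod_(i | A i) F i)^`() =
  \sum_(i | A i) (F i)^`() * \prod_(j | A j && (j != i)) F j.
Proof. exact/deriv_prod_seq/index_enum_uniq. Qed.

(** * Probability generating functions, with coefficients at integer indices *)

Section Coefz.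
Variable R : comNzRingType.
Implicit Types (P : {poly R}) (k : int).

(* Zero at negative indices, so that shifts of a mass function need no side
   condition. *)
Definition coefz P k : R := if k is Posz m then P`_m else 0.

Lemma coefz_lin (a b : R) P k :
  coefz ((a%:P + b *: 'X) * P) k = a * coefz P k + b * coefz P (k - 1).
Proof.
rewrite mulrDl -scalerAl !mul_polyC; case: k => [[|m]|m].
- by rewrite /= coefD !coefZ coefXM /= !mulr0.
- have -> : m.+1%:Z - 1 = m by lia.
  by rewrite /= coefD !coefZ coefXM.
- have -> : Negz m - 1 = Negz m.+1 by lia.
  by rewrite /= !mulr0 addr0.
Qed.

Lemma coefz1 k : coefz 1 k = (k == 0)%:R.
Proof. by case: k => [m|m] //=; rewrite coef1. Qed.

Lemma coefz_deriv P k : coefz P^`() k = (k + 1)%:~R * coefz P (k + 1).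
Proof.
case: k => [m|[|m]].
- by have -> : m%:Z + 1 = m.+1 by [lia]; rewrite /= coef_deriv mulr_natl.
- by rewrite mul0r.
- by have -> : Negz m.+1 + 1 = Negz m by [lia]; rewrite /= mulr0.
Qed.

Lemma coefz_sum (I : finType) (A : pred I) (F : I -> {poly R}) k :
  coefz (\sum_(i | A i) F i) k = \sum_(i | A i) coefz (F i) k.
Proof. by case: k => m /=; rewrite ?coef_sum // big1. Qed.

Lemma coefzZ (a : R) P k : coefz (a *: P) k = a * coefz P k.
Proof. by case: k => m /=; rewrite ?coefZ ?mulr0. Qed.

(** For parameters in [0, 1], the coefficients form the mass function of the sum of independent
    Bernoulli variables of parameters [p i], [i] in [A]. *)
Definition pgf (I : finType) (p : I -> R) (A : pred I) : {poly R} :=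
  \prod_(i | A i) ((1 - p i)%:P + p i *: 'X).

Lemma pgf_remove (I : finType) (p : I -> R) (A : pred I) i k : A i ->
  coefz (pgf p A) k =
  (1 - p i) * coefz (pgf p [pred j | A j && (j != i)]) k
  + p i * coefz (pgf p [pred j | A j && (j != i)]) (k - 1).
Proof. by move=> Ai; rewrite {1}/pgf (bigD1 i) //= coefz_lin. Qed.

Lemma pgf_euler (I : finType) (p : I -> R) (A : pred I) k :
  \sum_(i | A i) p i * coefz (pgf p [pred j | A j && (j != i)]) k =
  (k + 1)%:~R * coefz (pgf p A) (k + 1).
Proof.
rewrite -coefz_deriv deriv_prod coefz_sum; apply: eq_bigr => i _.
by rewrite derivD derivC add0r derivZ derivX -scalerAl mul1r coefzZ.
Qed.

End Coefz.

(** * Total positivity: Toeplitz minors of order two and three *)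

Section Toeplitz.
Variable R : realDomainType.
Implicit Types (u v : int -> R) (a b c k : int).

(** Minor of the matrix with entry [u (r - c)] in row [r] and column [c]: rows [a], [b] and columns
    0, 1. Likewise [toeplitz3] uses columns 0, 1, 2. *)
Definition toeplitz2 u a b : R := u a * u (b - 1) - u (a - 1) * u b.

Definition toeplitz3 u a b c : R :=
  u a * (u (b - 1) * u (c - 2) - u (b - 2) * u (c - 1))
  - u (a - 1) * (u b * u (c - 2) - u (b - 2) * u c)
  + u (a - 2) * (u b * u (c - 1) - u (b - 1) * u c).

(** Arbitrary ordered rows but consecutive columns: nonnegativity of this family survives
    multiplication by a linear factor. *)
Definition toeplitz_ge0 u :=
  (forall a b, a <= b -> 0 <= toeplitz2 u a b) /\
  (forall a b c, a <= b -> b <= c -> 0 <= toeplitz3 u a b c).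

Lemma toeplitz_ge0_1 : toeplitz_ge0 (coefz 1).
Proof.
(* Row [r] has a nonzero entry in columns 0, 1, 2 only if [r] is 0, 1 or 2. *)
have E r : [\/ r = 0, r = 1, r = 2 |
    [/\ coefz (1 : {poly R}) r = 0, coefz (1 : {poly R}) (r - 1) = 0 &
        coefz (1 : {poly R}) (r - 2) = 0]].
  have [->|r0] := eqVneq r 0; first exact: Or41.
  have [->|r1] := eqVneq r 1; first exact: Or42.
  have [->|r2] := eqVneq r 2; first exact: Or43.
  apply: Or44; rewrite !coefz1 !subr_eq0.
  by rewrite (negPf r0) (negPf r1) (negPf r2).
split=> [a b|a b c].
  rewrite /toeplitz2.
  by case: (E a) => [->|->|->|[-> -> _]];
    case: (E b) => [->|->|->|[-> -> _]] // _;
    rewrite ?coefz1 //=; lra.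
rewrite /toeplitz3.
by case: (E a) => [->|->|->|[-> -> ->]];
  case: (E b) => [->|->|->|[-> -> ->]] // _;
  case: (E c) => [->|->|->|[-> -> ->]] // _; rewrite ?coefz1 //=; lra.
Qed.

(* Row [r] of the Toeplitz matrix of [v] is a combination of the rows [r] and
   [r - 1] of that of [u]. *)
Lemma toeplitz_ge0_mul u v (q p : R) : 0 <= q -> 0 <= p ->
  (forall k, v k = q * u k + p * u (k - 1)) ->
  toeplitz_ge0 u -> toeplitz_ge0 v.
Proof.
move=> q0 p0 vE [u2 u3]; split=> [a b|a b c].
  (* Equal rows give a zero minor; for [a < b], lowering [b] by one keeps the rows in order. *)
  rewrite le_eqVlt => /predU1P[->|ab].
    by rewrite /toeplitz2 mulrC subrr.
  have -> : toeplitz2 v a b = q ^+ 2 * toeplitz2 u a b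
      + q * p * (toeplitz2 u (a - 1) b + toeplitz2 u a (b - 1))
      + p ^+ 2 * toeplitz2 u (a - 1) (b - 1).
    by rewrite /toeplitz2 !vE; ring.
  by do ?[apply: u2 | apply: exprn_ge0 | apply: addr_ge0 | apply: mulr_ge0] => //;
    lia.
rewrite le_eqVlt => /predU1P[->|ab].
  by move=> _; rewrite /toeplitz3 le_eqVlt; apply/orP; left; apply/eqP; ring.
rewrite le_eqVlt => /predU1P[->|bc].
  by rewrite /toeplitz3 le_eqVlt; apply/orP; left; apply/eqP; ring.
have -> : toeplitz3 v a b c = q ^+ 3 * toeplitz3 u a b c
    + q ^+ 2 * p * (toeplitz3 u (a - 1) b c + toeplitz3 u a (b - 1) c
                    + toeplitz3 u a b (c - 1))
    + q * p ^+ 2 * (toeplitz3 u (a - 1) (b - 1) c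
                    + toeplitz3 u (a - 1) b (c - 1)
                    + toeplitz3 u a (b - 1) (c - 1))
    + p ^+ 3 * toeplitz3 u (a - 1) (b - 1) (c - 1).
  have e2 r : v (r - 2) = q * u (r - 2) + p * u (r - 1 - 2).
    by rewrite vE; congr (_ + _ * u _); lia.
  by rewrite /toeplitz3 !e2 !vE; ring.
by do ?[apply: u3 | apply: exprn_ge0 | apply: addr_ge0 | apply: mulr_ge0] => //;
  lia.
Qed.

Lemma pgf_toeplitz_ge0 (I : finType) (p : I -> R) (A : pred I) :
  (forall i, 0 <= p i <= 1) -> toeplitz_ge0 (coefz (pgf p A)).
Proof.
move=> p01; rewrite /pgf.
elim/big_rec: _ => [|i P _ IH]; first exact: toeplitz_ge0_1.
have /andP[p0 p1] := p01 i.
apply: (@toeplitz_ge0_mul _ _ (1 - p i) (p i) _ _ _ IH) => //.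
  by rewrite subr_ge0.
by move=> k; exact: coefz_lin.
Qed.

Lemma pgf_ge0 (I : finType) (p : I -> R) (A : pred I) k :
  (forall i, 0 <= p i <= 1) -> 0 <= coefz (pgf p A) k.
Proof.
move=> p01; rewrite /pgf; elim/big_rec: _ k => [|i P _ IH] k.
  by rewrite coefz1 ler0n.
have /andP[p0 p1] := p01 i.
by rewrite coefz_lin addr_ge0 // mulr_ge0 // subr_ge0.
Qed.

End Toeplitz.

(** * Quadratic forms with nonpositive off-diagonal coefficients *)

Section Mmatrix.
Variables (R : realFieldType) (I : finType) (M : I -> I -> R) (w : I -> R).

(* With [y i = v i / w i], twice the quadratic form is
   2 \sum_i w_i y_i^2 (M w)_i - \sum_(i, j) w_i w_j M_ij (y_i - y_j)^2. *)
Lemma Zmatrix_quadratic_ge0 (v : I -> R) :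
  (forall i j, M i j = M j i) -> (forall i j, i != j -> M i j <= 0) ->
  (forall i, 0 < w i) -> (forall i, 0 <= \sum_j M i j * w j) ->
  0 <= \sum_i \sum_j v i * v j * M i j.
Proof.
move=> Msym Moff w0 Mw; pose y i := v i / w i.
have vE i : v i = w i * y i by rewrite /y mulrC divfK // gt_eqF.
pose S := \sum_i w i * y i ^+ 2 * \sum_j M i j * w j.
have S0 : 0 <= S.
  rewrite /S; apply: sumr_ge0 => i _; apply: mulr_ge0 => //.
  by rewrite mulr_ge0 ?sqr_ge0 // ltW.
have S1 : S = \sum_i \sum_j w i * w j * M i j * y i ^+ 2.
  by apply: eq_bigr => i _; rewrite mulr_sumr; apply: eq_bigr => j _; ring.
have S2 : S = \sum_i \sum_j w i * w j * M i j * y j ^+ 2.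
  rewrite S1 exchange_big; apply: eq_bigr => i _; apply: eq_bigr => j _ /=.
  by rewrite Msym; ring.
have D : 0 <= \sum_i \sum_j - (w i * w j * M i j * (y i - y j) ^+ 2).
  apply: sumr_ge0 => i _; apply: sumr_ge0 => j _.
  have [->|ij] := eqVneq i j; first by rewrite subrr expr0n mulr0 oppr0.
  rewrite -mulNr mulr_ge0 ?sqr_ge0 // -mulrN mulr_ge0 ?oppr_ge0 ?Moff //.
  by rewrite mulr_ge0 // ltW.
rewrite -(pmulr_rge0 _ (ltr0n R 2)).
suff -> : 2 * \sum_i \sum_j v i * v j * M i j =
  S + S + \sum_i \sum_j - (w i * w j * M i j * (y i - y j) ^+ 2).
  by rewrite !addr_ge0.
rewrite {1}S1 S2 -!big_split mulr_sumr; apply: eq_bigr => i _ /=.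
rewrite -!big_split mulr_sumr; apply: eq_bigr => j _ /=.
by rewrite !vE; ring.
Qed.

End Mmatrix.

(** * The quadratic inequality for the mass function *)

Section GLC.
Variables (R : realFieldType) (I : finType) (p v : I -> R).
Hypothesis p01 : forall i, 0 < p i < 1.

Let f := coefz (pgf p predT).
Let f1 i := coefz (pgf p [pred j | j != i]).
Let f2 i j := coefz (pgf p [pred l | (l != i) && (l != j)]).

(* With [f] the mass function of parameters [p], [flux k - flux (k - 1)] is
   minus the derivative of [f k] in the direction [v], and [flux2] plays the
   same role for second derivatives. *)
Definition flux k : R := \sum_i v i * coefz (pgf p [pred j | j != i]) k.
Definition flux2 k : R := \sum_i \sum_(j | j != i)
  v i * v j * coefz (pgf p [pred l | (l != i) && (l != j)]) k.

Let fE i k : f k = (1 - p i) * f1 i k + p i * f1 i (k - 1).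
Proof. exact: (@pgf_remove _ _ _ predT i). Qed.

Let f1E i j k : i != j -> f1 i k = (1 - p j) * f2 i j k + p j * f2 i j (k - 1).
Proof.
by move=> ij; apply: (@pgf_remove _ _ _ [pred j | j != i] j); rewrite /= eq_sym.
Qed.

Let f2C i j k : f2 i j k = f2 j i k.
Proof. by rewrite /f2; congr coefz; apply: eq_bigl => l /=; rewrite andbC. Qed.

Lemma glc k :
  flux2 k * (f (k + 1) ^+ 2 - f k * f (k + 2)) <=
  2 * flux k * flux (k + 1) * f (k + 1) - flux k ^+ 2 * f (k + 2)
  - flux (k + 1) ^+ 2 * f k.
Proof.
(* The zero diagonal of [h] lets [flux2] be summed over all pairs; [M i j] is then the symmetrized
   coefficient of [v i * v j] in the right side minus the left side. *)
pose h i j : R := if j != i then f2 i j k else 0.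
pose M i j := f (k + 1) * (f1 i k * f1 j (k + 1) + f1 j k * f1 i (k + 1))
  - f1 i k * f1 j k * f (k + 2) - f1 i (k + 1) * f1 j (k + 1) * f k
  - h i j * (f (k + 1) ^+ 2 - f k * f (k + 2)).
have p01w i : 0 <= p i <= 1 by case/andP: (p01 i) => *; rewrite !ltW.
suff : 0 <= \sum_i \sum_j v i * v j * M i j.
  suff -> : \sum_i \sum_j v i * v j * M i j =
    2 * flux k * flux (k + 1) * f (k + 1) - flux k ^+ 2 * f (k + 2)
    - flux (k + 1) ^+ 2 * f k - flux2 k * (f (k + 1) ^+ 2 - f k * f (k + 2)).
    by rewrite subr_ge0.
  have -> : flux2 k = \sum_i \sum_j v i * v j * h i j.
    apply: eq_bigr => i _; rewrite big_mkcond; apply: eq_bigr => j _.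
    by rewrite /h; case: ifP; rewrite ?mulr0.
  have gg a b : flux a * flux b = \sum_i \sum_j v i * v j * (f1 i a * f1 j b).
    rewrite big_distrlr /=; apply: eq_bigr => i _; apply: eq_bigr => j _.
    by rewrite /f1; ring.
  have -> : 2 * flux k * flux (k + 1) * f (k + 1) =
    f (k + 1) * (flux k * flux (k + 1) + flux (k + 1) * flux k) by ring.
  rewrite !expr2 !gg -big_split mulr_sumr !mulr_suml -!sumrB /=.
  apply: eq_bigr => i _.
  rewrite -big_split mulr_sumr !mulr_suml -!sumrB /=.
  by apply: eq_bigr => j _; rewrite /M; ring.
apply: (@Zmatrix_quadratic_ge0 _ _ _ p) => [i j|i j ij|i|i].
- by rewrite /M /h eq_sym f2C; case: ifP => _; ring.
(* Splitting off variables [i] and [j] writes every term through [u], which turns the claim into a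
   polynomial identity. *)
- set u := f2 i j.
  have ji : j != i by rewrite eq_sym.
  have F1i r : f1 i r = (1 - p j) * u r + p j * u (r - 1) by exact: f1E.
  have F1j r : f1 j r = (1 - p i) * u r + p i * u (r - 1).
    by rewrite (f1E _ ji) !(f2C j).
  have F r : f r = (1 - p i) * ((1 - p j) * u r + p j * u (r - 1))
      + p i * ((1 - p j) * u (r - 1) + p j * u (r - 1 - 1)).
    by rewrite (fE i) !F1i.
  have T : 0 <= toeplitz3 u k (k + 1) (k + 2).
    by apply: (pgf_toeplitz_ge0 _ p01w).2; lia.
  suff -> : M i j = - (p i * (1 - p i) * (p j * (1 - p j)) *
      toeplitz3 u k (k + 1) (k + 2)).
    have /andP[? ?] := p01 i; have /andP[? ?] := p01 j.
    by rewrite oppr_le0 !mulr_ge0 // ?subr_ge0 ltW.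
  rewrite /M /h ji -/u !F !F1i !F1j /toeplitz3.
  have -> : k + 1 - 1 = k by ring.
  have -> : k + 2 - 1 = k + 1 by ring.
  have -> : k + 2 - 2 = k by ring.
  have -> : k + 1 - 2 = k - 1 by ring.
  have -> : k + 1 - 1 = k by ring.
  have -> : k - 1 - 1 = k - 2 by ring.
  by ring.
- by case/andP: (p01 i).
have T : 0 <= toeplitz2 (f1 i) k (k + 1).
  by apply: (pgf_toeplitz_ge0 _ p01w).1; lia.
suff -> : \sum_j M i j * p j = f (k + 2) * (p i * toeplitz2 (f1 i) k (k + 1)).
  rewrite mulr_ge0 // ?mulr_ge0 //; first exact: pgf_ge0.
  by case/andP: (p01w i).
(* With these Euler identities the sum collapses to [f (k + 2) * (f1 i k * f (k + 1) - f1 i (k + 1)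
   * f k)]; splitting off [i] in [f] leaves the minor. *)
have G a : \sum_j p j * f1 j a = (a + 1)%:~R * f (a + 1).
  exact: (@pgf_euler _ _ p predT).
have H : \sum_j p j * h i j = (k + 1)%:~R * f1 i (k + 1).
  rewrite -(@pgf_euler _ _ p [pred j | j != i]) [RHS]big_mkcond.
  by apply: eq_bigr => j _; rewrite /h /=; case: ifP => _; rewrite ?mulr0.
have -> : \sum_j M i j * p j =
    f (k + 1) * (f1 i k * (\sum_j p j * f1 j (k + 1))
                 + f1 i (k + 1) * (\sum_j p j * f1 j k))
    - f1 i k * f (k + 2) * (\sum_j p j * f1 j k)
    - f1 i (k + 1) * f k * (\sum_j p j * f1 j (k + 1))
    - (f (k + 1) ^+ 2 - f k * f (k + 2)) * (\sum_j p j * h i j).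
  rewrite mulrDr !mulr_sumr -!big_split -!sumrB /=.
  by apply: eq_bigr => j _; rewrite /M; ring.
rewrite !G H /toeplitz2.
have -> : k + 1 + 1 = k + 2 by ring.
rewrite [f k](fE i) [f (k + 1)](fE i).
have -> : k + 1 - 1 = k by ring.
by rewrite !intrD; ring.
Qed.
End GLC.

(** * Support of the mass function and summation by parts *)

Lemma pgf_support (R : realDomainType) (I : finType) (p : I -> R) (A : pred I)
    k :
  (forall i, 0 < p i < 1) ->
  if (k <= #|A|)%N then (0 < (pgf p A)`_k : Prop) else (pgf p A)`_k = 0.
Proof.
move=> p01; rewrite -sum1_card /pgf.
(* Each factor has two positive coefficients and extends the support by one. *)
elim/big_rec2: _ k => [|i P c _ IH] k.
  by case: k => [|k]; rewrite coef1 /= ?ltr01.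
have /andP[p0 p1] := p01 i; rewrite -subr_gt0 in p1.
have := coefz_lin (1 - p i) (p i) P k; rewrite {1}/coefz => ->.
case: k => [|k].
  by rewrite /= mulr0 addr0 mulr_gt0 // (IH 0).
have -> : k.+1%:Z - 1 = k by lia.
rewrite /= add1n ltnS; have := IH k; have := IH k.+1.
case: (leqP k.+1 c) => [kc|ck].
  by rewrite (ltnW kc) => *; rewrite addr_gt0 // mulr_gt0.
move=> ->; rewrite mulr0 add0r; case: ifP => _ H; last by rewrite H mulr0.
by rewrite mulr_gt0.
Qed.

(** Coefficient [k] of [('X - 1) * P] is the coefficient of [P] at [k - 1] minus that at [k]; the
    last term cancels the extra [l N.+1] in the sum. *)
Lemma sum_by_parts (R : comNzRingType) (P : {poly R}) (l : nat -> R) N :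
  \sum_(k < N.+1) (('X - 1) * P)`_k * l k =
  \sum_(k < N.+1) P`_k * (l k.+1 - l k) - P`_N * l N.+1.
Proof.
have E k : (('X - 1) * P)`_k = (if k is k'.+1 then P`_k' else 0) - P`_k.
  by rewrite mulrBl mul1r coefB coefXM; case: k.
elim: N => [|N IH]; first by rewrite !big_ord1 E /=; ring.
rewrite big_ord_recr IH [in RHS]big_ord_recr /= E; ring.
Qed.

(** * Scalar logarithmic inequalities *)

Section Scalar.
Variable R : realType.

(** At [s = ln z] the gap is [expR s - expR (- s) - 2 * s], which vanishes at 0 and has derivative
    [(expR s - 1) ^+ 2 / expR s]. *)
Lemma ln_le_sub_inv (z : R) : 1 <= z -> 2 * ln z <= z - z^-1.
Proof.
move=> z1; have z0 : 0 < z by apply: lt_le_trans z1.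
pose F (s : R) := expR s - expR (- s) - 2 * s.
have dF (s : R) : is_derive s 1 F (expR s + expR (- s) - 2).
  by apply: is_derive_eq; rewrite /GRing.scale /=; ring.
have [c _] : exists2 c, c \in `[0, ln z] &
    F (ln z) - F 0 = (expR c + expR (- c) - 2) * (ln z - 0).
  apply: (@MVT_segment _ F (fun s => expR s + expR (- s) - 2)).
  - exact: ln_ge0.
  - by apply: derivable_within_continuous => x _; have [] := dF x.
have -> : F 0 = 0 by rewrite /F oppr0 mulr0 subr0 subrr.
rewrite /F expRN lnK ?posrE // !subr0 -subr_ge0 => ->.
rewrite mulr_ge0 ?ln_ge0 //.
have -> : expR c + expR (- c) - 2 = (expR c - 1) ^+ 2 / expR c.
  by rewrite expRN; field; rewrite gt_eqF // expR_gt0.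
by rewrite divr_ge0 ?sqr_ge0 // expR_ge0.
Qed.

(** Used with three consecutive masses [a], [b], [c], with [r], [s] consecutive values of [flux] and
    [h] one of [flux2]. For [h <= 0] the right side is nonnegative; for [h > 0] the bound on
    [ln (b / m)] brings in the hypothesis on [h]. *)
Lemma entropy_term_le (h r s a b c : R) : 0 < a -> 0 < b -> 0 < c ->
  a * c <= b ^+ 2 ->
  h * (b ^+ 2 - a * c) <= 2 * r * s * b - r ^+ 2 * c - s ^+ 2 * a ->
  h * (2 * ln b - ln a - ln c) <= r ^+ 2 / a + s ^+ 2 / c - 2 * r * s / b.
Proof.
move=> a0 b0 c0 acb hle.
(* The geometric mean turns the second difference of logarithms into [2 * ln (b / m)] with
   [b / m >= 1]. *)
pose m := Num.sqrt (a * c).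
have ac0 : 0 < a * c by rewrite mulr_gt0.
have m0 : 0 < m by rewrite /m sqrtr_gt0.
have m2 : m ^+ 2 = a * c by rewrite /m sqr_sqrtr // ltW.
have mb : m <= b.
  have h2 : m ^+ 2 <= b ^+ 2 by rewrite m2.
  by move: h2; rewrite ler_pXn2r // nnegrE ltW.
have an0 : a != 0 by rewrite gt_eqF.
have bn0 : b != 0 by rewrite gt_eqF.
have cn0 : c != 0 by rewrite gt_eqF.
have mn0 : m != 0 by rewrite gt_eqF.
have LE : 2 * ln b - ln a - ln c = 2 * ln (b / m).
  rewrite ln_div ?posrE // mulrBr.
  have -> : 2 * ln m = ln (m ^+ 2) by rewrite lnXn // mulr_natl.
  by rewrite m2 lnM ?posrE //; ring.
have z1 : 1 <= b / m by rewrite ler_pdivlMr // mul1r.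
have L0 : 0 <= 2 * ln (b / m) by rewrite mulr_ge0 // ln_ge0.
(* The right side with [b] replaced by [m], which is a square over a positive number. *)
pose W := r ^+ 2 / a + s ^+ 2 / c - 2 * r * s / m.
have W0 : 0 <= W.
  have -> : W = (r * c - s * m) ^+ 2 / (a * c ^+ 2).
    have -> : (r * c - s * m) ^+ 2 =
      r ^+ 2 * c ^+ 2 - 2 * r * s * c * m + s ^+ 2 * m ^+ 2 by ring.
    have -> : 2 * r * s * c * m = 2 * r * s * c * (m ^+ 2) / m by field.
    by rewrite m2 /W; field; rewrite an0 cn0 mn0.
  by rewrite divr_ge0 ?sqr_ge0 // ltW // mulr_gt0 // exprn_gt0.
have RHS0 : 0 <= r ^+ 2 / a + s ^+ 2 / c - 2 * r * s / b.
  have [rs0|rs0] := leP 0 (r * s).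
    apply: le_trans W0 _; rewrite /W lerD2l lerN2 -!mulrA ler_pM2l // !mulrA.
    by rewrite ler_wpM2l // lef_pV2.
  have := divr_ge0 (sqr_ge0 r) (ltW a0); have := divr_ge0 (sqr_ge0 s) (ltW c0).
  have : 0 <= - (r * s) / b by apply: divr_ge0; rewrite ?oppr_ge0 ltW.
  rewrite -!mulrA; lra.
rewrite LE; have [h0|h0] := leP h 0.
  by apply: le_trans RHS0; rewrite mulr_le0_ge0.
apply: (@le_trans _ _ (h * (b / m - (b / m)^-1))).
  by rewrite ler_pM2l // ln_le_sub_inv.
have -> : h * (b / m - (b / m)^-1) = h * (b ^+ 2 - a * c) / (b * m).
  by rewrite -m2; field; rewrite bn0 mn0.
apply: (@le_trans _ _ ((2 * r * s * b - r ^+ 2 * c - s ^+ 2 * a) / (b * m))).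
  by rewrite ler_wpM2r // invr_ge0 ltW // mulr_gt0.
have -> : (2 * r * s * b - r ^+ 2 * c - s ^+ 2 * a) / (b * m) =
   r ^+ 2 / a + s ^+ 2 / c - 2 * r * s / b - (1 + m / b) * W.
  have -> : (1 + m / b) * W =
      W + m ^+ 2 / (b * m) * (r ^+ 2 / a + s ^+ 2 / c) - 2 * r * s / b.
    by rewrite /W; field; rewrite an0 bn0 cn0 mn0.
  by rewrite m2 /W; field; rewrite an0 bn0 cn0 mn0.
by rewrite gerBl mulr_ge0 // addr_ge0 // divr_ge0 // ltW.
Qed.
End Scalar.

(** * Sign of the second derivative of the negative entropy *)

Section SecondDerivative.
Variables (R : realType) (I : finType) (p v : I -> R).
Hypothesis p01 : forall i, 0 < p i < 1.

Definition flux_poly : {poly R} :=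
  \sum_i v i *: pgf p [pred j | j != i].

Definition flux2_poly : {poly R} := \sum_i \sum_(j | j != i)
  (v i * v j) *: pgf p [pred l | (l != i) && (l != j)].

Let f := pgf p predT.

Lemma flux_polyE k : coefz flux_poly k = flux p v k.
Proof. by rewrite coefz_sum; apply: eq_bigr => i _; rewrite coefzZ. Qed.

Lemma flux2_polyE k : coefz flux2_poly k = flux2 p v k.
Proof.
rewrite coefz_sum; apply: eq_bigr => i _; rewrite coefz_sum.
by apply: eq_bigr => j _; rewrite coefzZ.
Qed.

Let f_gt0 k : (k <= #|I|)%N -> 0 < f`_k.
Proof. by move=> kI; have := pgf_support predT k p01; rewrite kI. Qed.

Let p01w i : 0 <= p i <= 1.
Proof. by case/andP: (p01 i) => *; rewrite !ltW. Qed.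

Let pgf_nat_ge0 k : 0 <= f`_k.
Proof. exact: (@pgf_ge0 _ _ p predT k). Qed.

Lemma flux_poly_eq0 k : (#|I| <= k)%N -> flux_poly`_k = 0.
Proof.
move=> Ik; rewrite coef_sum big1 // => i _; rewrite coefZ.
have := pgf_support [pred j | j != i] k p01; rewrite cardC1.
have I0 : (0 < #|I|)%N by apply/card_gt0P; exists i.
by rewrite leqNgt prednK // Ik => /= ->; rewrite mulr0.
Qed.

Lemma flux2_poly_eq0 k : (#|I| <= k.+1)%N -> flux2_poly`_k = 0.
Proof.
move=> Ik; rewrite coef_sum big1 // => i _; rewrite coef_sum big1 // => j ji.
rewrite coefZ.
have := pgf_support [pred l | (l != i) && (l != j)] k p01.
have C := cardC (pred2 i j); rewrite card2 eq_sym ji in C.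
have <- : #|[predC pred2 i j]| = #|[pred l | (l != i) && (l != j)]|.
  by apply: eq_card => l; rewrite !inE negb_or.
have /negPf -> : ~~ (k <= #|[predC pred2 i j]|)%N.
  by move: Ik; rewrite -ltnNge -ltnS -C.
by move=> ->; rewrite mulr0.
Qed.

(** Two summations by parts move both factors ['X - 1] onto the logarithms, giving second
    differences that [entropy_term_le] controls. *)
Lemma entropy_second_derivative_ge0 :
  0 <= \sum_(k < #|I|.+1) (('X - 1) * (('X - 1) * flux2_poly))`_k * ln f`_k
     + \sum_(k < #|I|.+1) (('X - 1) * flux_poly)`_k ^+ 2 / f`_k.
Proof.
set n := #|I|; pose g k := flux_poly`_k; pose h k := flux2_poly`_k.
have gz k : (n <= k)%N -> g k = 0 by exact: flux_poly_eq0.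
have hz k : (n <= k.+1)%N -> h k = 0 by exact: flux2_poly_eq0.
rewrite (sum_by_parts _ (fun k => ln f`_k)).
rewrite (sum_by_parts _ (fun k => ln f`_k.+1 - ln f`_k)) -!/(h _).
have -> : (('X - 1) * flux2_poly)`_n = 0.
  rewrite mulrBl mul1r coefB coefXM -/(h n) hz // subr0.
  by case: eqP => // n0; rewrite -/(h _) hz // prednK // lt0n; apply/eqP.
rewrite (hz n) // !mul0r !subr0.
(* [B k] takes one piece from each of the expanded squares at [k], [k.+1] and [k.+2], to be paired
   with coefficient [h k]; the other terms in [E] are boundary terms. *)
pose B k :=
  g k ^+ 2 / f`_k + g k.+1 ^+ 2 / f`_k.+2 - 2 * g k * g k.+1 / f`_k.+1.
have E N : \sum_(k < N.+1) (('X - 1) * flux_poly)`_k ^+ 2 / f`_k =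
    \sum_(k < N.+1) B k + g 0 ^+ 2 / f`_1 - g N ^+ 2 / f`_N.+1
    - g N.+1 ^+ 2 / f`_N.+2 + 2 * g N * g N.+1 / f`_N.+1.
  elim: N => [|N IH].
    by rewrite !big_ord1 mulrBl mul1r coefB coefXM /= -/(g 0) /B; ring.
  rewrite big_ord_recr IH [in RHS]big_ord_recr /=.
  by rewrite mulrBl mul1r coefB coefXM /= -/(g N) -/(g N.+1) /B; ring.
rewrite E (gz n) // (gz n.+1) // expr0n /= mulr0 !mul0r !subr0 addr0 addrA.
rewrite -big_split /=.
rewrite addr_ge0 //; last by rewrite divr_ge0 ?sqr_ge0 // pgf_nat_ge0.
apply: sumr_ge0 => k _.
(* When [n <= k.+1], the mass at [k.+2] is zero and its logarithm and inverse are default values;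
   [h k = 0] and [g k.+1 = 0] remove them. *)
have [kn|kn] := leqP n k.+1.
  rewrite -/(h k) hz // mul0r add0r /B (gz k.+1) // ?mulr0 expr0n /= !mul0r.
  rewrite subr0 addr0.
  by rewrite divr_ge0 ?sqr_ge0 // pgf_nat_ge0.
have k1 : (k : nat)%:Z + 1 = k.+1 by lia.
have k2 : (k : nat)%:Z + 2 = k.+2 by lia.
have G := glc v p01 k.
have k12 : k.+1%:Z <= k.+2 by lia.
have T := (pgf_toeplitz_ge0 predT p01w).1 _ _ k12.
have T1 : k.+1%:Z - 1 = k by lia.
have T2 : k.+2%:Z - 1 = k.+1 by lia.
rewrite -!flux_polyE -!flux2_polyE k1 k2 /= in G.
rewrite /toeplitz2 T1 T2 /= subr_ge0 -expr2 in T.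
have := entropy_term_le (f_gt0 (ltnW (ltnW kn))) (f_gt0 (ltnW kn))
  (f_gt0 kn) T G.
rewrite -/f -/(h k) -/(g k) -/(g k.+1) -/(B k) -subr_ge0; congr (0 <= _).
by rewrite /B; ring.
Qed.

End SecondDerivative.

(** * Generating functions along a segment *)

Section Path.
Variables (R : realType) (I : finType) (x v : I -> R).

Definition affine_path (t : R) (i : I) : R := x i + t * v i.

(* [pgf (affine_path t) A] as a polynomial in [t] over {poly R}, so that formal
   derivatives apply. *)
Definition pgf_path (A : pred I) : {poly {poly R}} :=
  \prod_(i | A i) (((1 - x i)%:P + x i *: 'X)%:P + (v i *: ('X - 1)) *: 'X).

Lemma horner_pgf_path A t : (pgf_path A).[t%:P] = pgf (affine_path t) A.
Proof.
rewrite horner_prod; apply: eq_bigr => i _.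
rewrite !hornerE /affine_path -!mul_polyC !(polyCB, polyCD, polyCM); ring.
Qed.

Lemma deriv_pgf_path A : (pgf_path A)^`() =
  \sum_(i | A i) (v i *: ('X - 1))%:P * pgf_path [pred j | A j && (j != i)].
Proof.
rewrite deriv_prod; apply: eq_bigr => i _; congr (_ * _).
by rewrite derivD derivC add0r derivZ derivX alg_polyC.
Qed.

Lemma horner_deriv_pgf_path t :
  (pgf_path predT)^`().[t%:P] = ('X - 1) * flux_poly (affine_path t) v.
Proof.
rewrite deriv_pgf_path horner_sum mulr_sumr; apply: eq_bigr => i _.
by rewrite hornerM hornerC horner_pgf_path -scalerAl -scalerAr.
Qed.

Lemma horner_deriv2_pgf_path t :
  (pgf_path predT)^`()^`().[t%:P] =
  ('X - 1) * (('X - 1) * flux2_poly (affine_path t) v).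
Proof.
rewrite deriv_pgf_path raddf_sum horner_sum !mulr_sumr; apply: eq_bigr => i _.
rewrite /= derivM derivC mul0r add0r deriv_pgf_path hornerM horner_sum.
rewrite hornerC !mulr_sumr; apply: eq_bigr => j ji.
rewrite hornerM hornerC horner_pgf_path.
by rewrite -!scalerAl -!scalerAr scalerA.
Qed.

End Path.

(** Taking coefficient [k] of each coefficient of [G] gives a real polynomial [Q G] in [t], and [Q]
    commutes with derivation. *)
Lemma is_derive_coef_horner (R : realType) (G : {poly {poly R}}) k (t : R) :
  is_derive t 1 (fun t : R => G.[t%:P]`_k) (G^`().[t%:P])`_k.
Proof.
pose Q (H : {poly {poly R}}) := \poly_(i < size H) H`_i`_k.
have QE H (s : R) : H.[s%:P]`_k = (Q H).[s].
  rewrite horner_coef coef_sum horner_poly; apply: eq_bigr => i _.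
  by rewrite -polyC_exp coefMC.
have QC H i : (Q H)`_i = H`_i`_k.
  by rewrite coef_poly; case: ltnP => // Hi; rewrite [H`_i]nth_default ?coef0.
have QD : (Q G)^`() = Q G^`().
  by apply/polyP => i; rewrite coef_deriv !QC coef_deriv coefMn.
have -> : (fun t : R => G.[t%:P]`_k) = horner (Q G).
  by apply/funext => s; rewrite QE.
by rewrite QE -QD; exact: is_derive_poly.
Qed.

(** * Convexity along segments in the open cube *)

Definition neg_entropy (R : realType) (N : nat) (P : {poly R}) : R :=
  \sum_(k < N.+1) P`_k * ln P`_k.

Section Convexity.
Variables (R : realType) (I : finType) (x v : I -> R).
Let G := pgf_path x v predT.
Let f k (t : R) := G.[t%:P]`_k.
Let f' k (t : R) := G^`().[t%:P]`_k.
Let f'' k (t : R) := G^`()^`().[t%:P]`_k.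
Let n := #|I|.

Let F (t : R) := \sum_(k < n.+1) f k t * ln (f k t).
Let F' (t : R) := \sum_(k < n.+1) f' k t * (ln (f k t) + 1).
Let F'' (t : R) :=
  \sum_(k < n.+1) (f'' k t * (ln (f k t) + 1) + f' k t ^+ 2 / f k t).

Let interior t := forall i, 0 < affine_path x v t i < 1.

Let f_gt0 (k : 'I_n.+1) t : interior t -> 0 < f k t.
Proof.
move=> /(pgf_support predT k); rewrite /f horner_pgf_path.
by have -> : (k <= #|I|)%N by rewrite -ltnS ltn_ord.
Qed.

Let dlnf (k : 'I_n.+1) t : interior t ->
  is_derive t 1 (fun t : R => ln (f k t)) (f' k t / f k t).
Proof.
move=> it; have df := is_derive_coef_horner G k t.
have dl := is_derive1_ln (f_gt0 k it).
exact: (is_derive_eq (is_derive1_comp dl df) (mulrC _ _)).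
Qed.

Let dF t : interior t -> is_derive t 1 F (F' t).
Proof.
move=> it.
have -> : F = \sum_(k < n.+1) (fun t => f k t * ln (f k t)).
  by apply/funext => s; rewrite fct_sumE.
apply: is_derive_sum => k.
have df := is_derive_coef_horner G k t.
have dl := dlnf k it.
apply: is_derive_eq.
rewrite /GRing.scale /= mulrDr mulr1 addrC -/(f k t) -/(f' k t).
rewrite mulrCA divff ?mulr1; last by rewrite gt_eqF // f_gt0.
by rewrite mulrC.
Qed.

Let dF' t : interior t -> is_derive t 1 F' (F'' t).
Proof.
move=> it.
have -> : F' = \sum_(k < n.+1) (fun t => f' k t * (ln (f k t) + 1)).
  by apply/funext => s; rewrite fct_sumE.
apply: is_derive_sum => k.
have df := is_derive_coef_horner G^`() k t.
have dl := dlnf k it.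
apply: is_derive_eq.
rewrite /GRing.scale /= -/(f' k t) -/(f'' k t) addr0; ring.
Qed.

Let F''_ge0 t : interior t -> 0 <= F'' t.
Proof.
move=> it; rewrite /F'' big_split /=.
have fE k : f k t = (pgf (affine_path x v t) predT)`_k.
  by rewrite /f horner_pgf_path.
have f'E k : f' k t = (('X - 1) * flux_poly (affine_path x v t) v)`_k.
  by rewrite /f' horner_deriv_pgf_path.
have f''E k : f'' k t =
    (('X - 1) * (('X - 1) * flux2_poly (affine_path x v t) v))`_k.
  by rewrite /f'' horner_deriv2_pgf_path.
have := entropy_second_derivative_ge0 v it; congr (_ <= _ + _); last first.
  by apply: eq_bigr => k _; rewrite f'E fE.
(* The [+ 1] in [F''] contributes nothing: the second derivative of the generating function has a
   factor ['X - 1], so its coefficients sum to zero. *)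
have S0 : \sum_(k < n.+1) f'' k t * 1 = 0.
  under eq_bigr do rewrite f''E.
  rewrite (sum_by_parts _ (fun=> 1)) big1 => [|k _]; last first.
    by rewrite subrr mulr0.
  rewrite sub0r mulrBl mul1r coefB coefXM (@flux2_poly_eq0 _ _ _ v it n) //.
  rewrite subr0.
  case: eqP => [_|/eqP n0]; first by rewrite mul0r oppr0.
  by rewrite flux2_poly_eq0 ?mul0r ?oppr0 // prednK // lt0n.
under [RHS]eq_bigr do rewrite mulrDr.
rewrite big_split /= S0 addr0; apply: eq_bigr => k _.
by rewrite f''E fE.
Qed.

Lemma neg_entropy_path_convex (s : {i01 R}) : interior 0 -> interior 1 ->
  neg_entropy n (pgf (affine_path x v (1 - s%:num)) predT) <=
  s%:num * neg_entropy n (pgf (affine_path x v 0) predT) +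
  (1 - s%:num) * neg_entropy n (pgf (affine_path x v 1) predT).
Proof.
move=> i0 i1.
have it t : 0 <= t <= 1 -> interior t.
  move=> /andP[t0 t1] i; move: (i0 i) (i1 i).
  rewrite /affine_path mul0r mul1r addr0.
  move: t0; rewrite le_eqVlt => /predU1P[<-|t0]; first by rewrite mul0r addr0.
  move=> /andP[a0 a1] /andP[b0 b1].
  have ? : 0 < t * (x i + v i) by rewrite mulr_gt0.
  have ? : 0 < t * (1 - (x i + v i)) by rewrite mulr_gt0 // subr_gt0.
  have ? : 0 <= (1 - t) * x i by rewrite mulr_ge0 ?subr_ge0 // ltW.
  have ? : 0 <= (1 - t) * (1 - x i) by rewrite mulr_ge0 ?subr_ge0 // ltW.
  by apply/andP; split; nra.
have FE t : neg_entropy n (pgf (affine_path x v t) predT) = F t.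
  by apply: eq_bigr => k _; rewrite /f horner_pgf_path.
rewrite !FE.
have itoo (t : R) : t \in `]0, 1[ -> interior t.
  by rewrite in_itv => /andP[? ?]; apply: it; rewrite !ltW.
(* [F'] is known to be the derivative of [F] only at interior parameters, so the two are identified
   near [t] before differentiating again. *)
have DF (t : R) : t \in `]0, 1[ -> {near t, F' =1 'D_1 F}.
  move=> t01; near=> u.
  have /dF[_ ->] // : interior u.
  by apply: itoo; near: u; exact: near_in_itvoo.
have DF' (t : R) : t \in `]0, 1[ -> is_derive t 1 ('D_1 F) (F'' t).
  by move=> t01; apply: near_eq_is_derive (DF t t01) (dF' (itoo _ t01)).
have := @second_derivative_convex R F 0 1 _ _ _ _ _ s ler01.
rewrite !convRE mulr0 add0r mulr1; apply.
- by move=> t t01; have [_ ->] := DF' t t01; exact/F''_ge0/itoo.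
- have [/derivable1_diffP/differentiable_continuous] := dF i1.
  by move=> ? _; exact: cvg_at_left_filter.
- have [/derivable1_diffP/differentiable_continuous] := dF i0.
  by move=> ? _; exact: cvg_at_right_filter.
- by move=> t t01; have [] := dF (itoo _ t01).
- by move=> t t01; have [] := DF' t t01.
Unshelve. all: by end_near. Qed.
End Convexity.

(** * The law of a sum of independent Bernoulli variables *)

Lemma coef_pgf (R : comNzRingType) (I : finType) (p : I -> R) k :
  (pgf p predT)`_k =
  \sum_(A : {set I} | #|A| == k) \prod_i (if i \in A then p i else 1 - p i).
Proof.
rewrite /pgf; under eq_bigr do rewrite addrC.
(* In the expansion, [A] is the set of factors that contribute their ['X] term. *)
rewrite bigA_distr coef_sum big_mkcond [RHS]big_mkcond /=.
apply: eq_bigr => A _.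
have -> : \prod_i (if i \in A then p i *: 'X else (1 - p i)%:P) =
    (\prod_i (if i \in A then p i else 1 - p i)) *: 'X^#|A|.
  rewrite -mul_polyC rmorph_prod -sum1_card -prodrXr [X in _ * X]big_mkcond.
  rewrite -big_split /=.
  by apply: eq_bigr => i _; case: ifP => _; rewrite ?mulr1 // expr1 mul_polyC.
by rewrite coefZ coefXn eq_sym; case: eqP => _; rewrite ?mulr1 ?mulr0.
Qed.

Section PMF.
Local Open Scope ereal_scope.
Variables (R : realType) (d : measure_display) (T : measurableType d).
Variables (P : probability T R) (n : nat) (X : 'I_n -> {RV P >-> R}).
Variable p : 'I_n -> R.
Hypothesis Xp : forall i, bernoulli_RV (X i) (p i).
Hypothesis Xind : independent_RVs X.

Let E (A : {set 'I_n}) : set T :=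
  \bigcap_(i in [set` [set: 'I_n]%SET]) X i @^-1` [set (i \in A)%:R]%R.

Let mE A : measurable (E A).
Proof.
apply: fin_bigcap_measurable => [|i _]; first exact: finite_finset.
by rewrite -[X in measurable X]setTI; apply: measurable_funP.
Qed.

Let EP A w : E A w <-> forall i, X i w = (i \in A)%:R%R.
Proof. by split=> [h i|h i _]; [apply: h; rewrite /= inE|exact: h]. Qed.

Let PE A : P (E A) = (\prod_i (if i \in A then p i else 1 - p i)%R)%:E.
Proof.
rewrite /E (Xind (B := fun i => [set (i \in A)%:R%R])); last first.
  by move=> i _; exact: measurable_set1.
rewrite -prodEFin big_mkcond /=; apply: eq_bigr => i _; rewrite inE.
by have [X1 X0] := Xp i; case: ifP => _; [exact: X1|exact: X0].
Qed.

Let P_bigcupE (Q : pred {set 'I_n}) : P (\bigcup_(A in [set` Q]) E A) =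
  (\sum_(A | Q A) \prod_i (if i \in A then p i else 1 - p i)%R)%:E.
Proof.
have -> : [set` Q] = [set` enum Q].
  by apply/seteqP; split=> A /=; rewrite mem_enum.
rewrite measure_fin_bigcup //; last first.
  move=> A B _ _ [w [/EP wA /EP wB]]; apply/setP => i.
  have := wA i; rewrite wB => /eqP; rewrite eqr_nat.
  by case: (i \in A); case: (i \in B).
rewrite -fsbig_seq ?enum_uniq // big_enum -sumEFin; apply: eq_bigr => A _.
exact: PE.
Qed.

Lemma pmf_sum_bernoulli k : (pmf (sum_RV X) k%:R = (pgf p predT)`_k)%R.
Proof.
have sum_E A w : E A w -> sum_RV X w = #|A|%:R.
  move=> /EP EA; rewrite sum_RVE -sum1_card natr_sum [RHS]big_mkcond /=.
  by apply: eq_bigr => i _; rewrite EA; case: (i \in A).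
(* The variables may take values other than 0 and 1, but only outside [Om]. Its probability is the
   product of the sums [p i + (1 - p i)], hence 1. *)
pose Om := \bigcup_(A in [set` predT]) E A.
have mOm : measurable Om by apply: fin_bigcup_measurable.
have POm : P Om = 1.
  rewrite P_bigcupE -bigA_distr big1 // => i _ /=.
  by rewrite addrC subrK.
have POmC : P (~` Om) = 0 by rewrite probability_setC // POm subee.
have mS : measurable (sum_RV X @^-1` [set k%:R]).
  by rewrite -[X in measurable X]setTI; apply: measurable_funP.
rewrite /pmf coef_pgf.
have -> : P (sum_RV X @^-1` [set k%:R]) =
    P (\bigcup_(A in [set` [pred A : {set 'I_n} | #|A| == k]]) E A).
  have -> : P (sum_RV X @^-1` [set k%:R]) =
      P (sum_RV X @^-1` [set k%:R] `\` Om)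
      + P (sum_RV X @^-1` [set k%:R] `&` Om).
    exact: measureDI.
  have -> : P (sum_RV X @^-1` [set k%:R] `\` Om) = 0.
    apply: (@subset_measure0 _ _ _ _ _ (~` Om)).
    - exact: measurableD.
    - exact: measurableC.
    - by move=> w [].
    - exact: POmC.
  rewrite add0e; congr (P _); apply/seteqP; split.
    move=> w [/= Sw [A _ EA]]; exists A => //=.
    have : (#|A|%:R == k%:R :> R)%R by rewrite -(sum_E _ _ EA) Sw.
    by rewrite eqr_nat.
  move=> w [A /= Ak EA]; split; last by exists A.
  by rewrite /= (sum_E _ _ EA) (eqP Ak).
by rewrite P_bigcupE.
Qed.
End PMF.

(** * Continuity at the boundary and passage to the closed cube *)

Lemma norm_xlnx_le (R : realType) (y : R) :
  y < 1 -> `|y * ln y| <= Num.sqrt `|y|.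
Proof.
move=> y1; have [y0|y0] := leP y 0.
  by rewrite ln0 // mulr0 normr0 sqrtr_ge0.
rewrite (gtr0_norm y0); set s := Num.sqrt y.
have s0 : 0 < s by rewrite /s sqrtr_gt0.
have ys : y = s ^+ 2 by rewrite /s sqr_sqrtr // ltW.
have s1 : s <= 1.
  rewrite leNgt; apply/negP => /ltW h.
  by have := exprn_ege1 2 h; rewrite -ys leNgt y1.
have lny : ln y <= 0 by rewrite ln_le0 // ltW.
rewrite ler0_norm; last by rewrite mulr_ge0_le0 // ltW.
(* This gives [- 2 * ln s <= s^-1 - s]; multiplied by [s ^+ 2], it bounds [- (y * ln y)] by
   [s - s ^+ 3]. *)
have := @ln_le_sub_inv R s^-1; rewrite invf_ge1 // => /(_ s1).
rewrite lnV ?posrE // invrK => h.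
have -> : ln y = 2 * ln s by rewrite ys lnXn // mulr_natl.
have : s ^+ 2 * (2 * - ln s) <= s ^+ 2 * (s^-1 - s).
  by rewrite ler_wpM2l // exprn_ge0 // ltW.
have -> : s ^+ 2 * (s^-1 - s) = s - s ^+ 3 by field; rewrite gt_eqF.
have : 0 <= s ^+ 3 by rewrite exprn_ge0 // ltW.
by rewrite ys; lra.
Qed.

(** Negative arguments give 0 since [ln] vanishes there; at 0 the function is squeezed by the square
    root bound. *)
Lemma continuous_xlnx (R : realType) : continuous (fun x : R => x * ln x).
Proof.
move=> x; have [x0|x0|->] := ltgtP x 0.
- have : (fun=> 0 : R) y @[y --> x] --> x * ln x.
    by rewrite ln0 ?ltW // mulr0; exact: cvg_cst.
  apply: cvg_trans; apply: near_eq_cvg; near=> y.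
  rewrite ln0 ?mulr0 // ltW //; near: y; exact: lt_nbhsl.
- by apply: cvgM; [exact: cvg_id|exact: continuous_ln].
have S : Num.sqrt `|y| @[y --> (0 : R)] --> (0 : R).
  have : {for (0 : R), continuous (@Num.sqrt R \o Num.norm)}.
    by apply: continuous_comp; [exact: norm_continuous|exact: sqrt_continuous].
  by rewrite /prop_for /continuous_at /= normr0 sqrtr0.
rewrite /continuous_at mul0r.
apply: (@squeeze_cvgr _ _ _ _ (fun y => - Num.sqrt `|y|)
  (fun y => Num.sqrt `|y|)) => //.
  near=> y; rewrite -ler_norml; apply: norm_xlnx_le.
  by near: y; exact: lt_nbhsl.
by rewrite -[X in _ --> X]oppr0; exact: cvgN.
Unshelve. all: by end_near. Qed.

Lemma continuous_neg_entropy_path (R : realType) (I : finType)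
    (x v : I -> R) N :
  continuous (fun t : R => neg_entropy N (pgf (affine_path x v t) predT)).
Proof.
have E : (fun t : R => neg_entropy N (pgf (affine_path x v t) predT)) =
    (fun t : R => \sum_(k < N.+1) ((fun y : R => y * ln y) \o
      (fun t : R => (pgf_path x v predT).[t%:P]`_k)) t).
  by apply/funext => s; apply: eq_bigr => k _ /=; rewrite horner_pgf_path.
rewrite E; apply: continuous_big => [|k _ t]; first exact: add_continuous.
apply: continuous_comp; last exact: continuous_xlnx.
apply/differentiable_continuous/derivable1_diffP.
by have [] := is_derive_coef_horner (pgf_path x v predT) k t.
Qed.

Lemma neg_entropy_pgf_convex (R : realType) (I : finType) (a b : I -> R)
    (s : {i01 R}) :
  (forall i, 0 <= a i <= 1) -> (forall i, 0 <= b i <= 1) ->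
  neg_entropy #|I| (pgf (fun i => s%:num * a i + (1 - s%:num) * b i) predT) <=
  s%:num * neg_entropy #|I| (pgf a predT)
  + (1 - s%:num) * neg_entropy #|I| (pgf b predT).
Proof.
move=> a01 b01; set c := fun i => _ + _.
(* [push q e] moves [q] towards the centre of the cube, into its interior. *)
pose push (q : I -> R) e := affine_path q (fun i => 2^-1 - q i) e.
pose H q e := neg_entropy #|I| (pgf (push q e) predT).
have Hcvg q : H q e @[e --> (0 : R)^'+] --> neg_entropy #|I| (pgf q predT).
  have -> : neg_entropy #|I| (pgf q predT) = H q 0.
    congr (neg_entropy _ (pgf _ _)); apply/funext => i.
    by rewrite /push /affine_path mul0r addr0.
  by apply: cvg_at_right_filter; exact: continuous_neg_entropy_path.
have Rcvg : s%:num * H a e + (1 - s%:num) * H b e @[e --> (0 : R)^'+] -->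
    s%:num * neg_entropy #|I| (pgf a predT)
    + (1 - s%:num) * neg_entropy #|I| (pgf b predT).
  by apply: cvgD; apply: cvgMl_tmp; exact: Hcvg.
apply: (ler_cvg_to (Hcvg c) Rcvg).
near=> e.
have e0 : 0 < e by near: e; exact: nbhs_right_gt.
have e1 : e < 1 by near: e; exact: nbhs_right_lt.
have push01 q i : 0 <= q i <= 1 -> 0 < push q e i < 1.
  by move=> /andP[q0 q1]; rewrite /push /affine_path; apply/andP; split; nra.
pose w i := push b e i - push a e i.
have w0 : affine_path (push a e) w 0 = push a e.
  by apply/funext => i; rewrite /affine_path mul0r addr0.
have w1 : affine_path (push a e) w 1 = push b e.
  by apply/funext => i; rewrite /affine_path mul1r subrKC.
(* [push q e] is affine in [q], so it commutes with convex combinations. *)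
have ws : affine_path (push a e) w (1 - s%:num) = push c e.
  by apply/funext => i; rewrite /affine_path /w /push /affine_path /c; ring.
have := @neg_entropy_path_convex R I (push a e) w s; rewrite w0 w1 ws; apply.
  by move=> i; exact: push01.
by move=> i; exact: push01.
Unshelve. all: by end_near. Qed.

Theorem theorem1p2 (R : realType) (n : nat) (n_ge1 : (1 <= n)%N)
    (d : 'rV[R]_n -> measure_display)
    (T : forall p : 'rV[R]_n, measurableType (d p))
    (P : forall p : 'rV[R]_n, probability (T p) R)
    (X : forall p : 'rV[R]_n, 'I_n -> {RV (P p) >-> R})
    (X_bernoulli : forall p, p \in unit_cube R n ->
       forall i, bernoulli_RV (X p i) (p ord0 i))
    (X_indep : forall p, p \in unit_cube R n -> independent_RVs (X p)) :
  concave_function (@unit_cube R n)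
    (fun p => shannon_entropy n (sum_RV (X p))).
Proof.
(* The probability space may vary with [p]; the entropy sees only the mass function, which
   independence and the marginals determine. *)
have entropyE p : p \in unit_cube R n -> shannon_entropy n (sum_RV (X p)) =
    - neg_entropy #|'I_n| (pgf (fun i => p ord0 i) predT).
  move=> p01; rewrite card_ord; congr (- _); apply: eq_bigr => k _.
  by rewrite (pmf_sum_bernoulli (X_bernoulli p p01) (X_indep p p01)).
move=> t x y x01 y01.
have x01' i : 0 <= x ord0 i <= 1 by move: x01; rewrite inE; exact.
have y01' i : 0 <= y ord0 i <= 1 by move: y01; rewrite inE; exact.
have convE i : conv t x y ord0 i =
    t%:num * x ord0 i + (1 - t%:num) * y ord0 i by rewrite !mxE.
have t0 : 0 <= t%:num by [].
have t1 : t%:num <= 1 by [].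
have z01 : conv t x y \in unit_cube R n.
  rewrite inE => i; rewrite convE.
  by move: (x01' i) (y01' i) => /andP[? ?] /andP[? ?]; apply/andP; split; nra.
rewrite !entropyE // convRE /= !mulrN -opprD lerN2.
have -> : (fun i => conv t x y ord0 i) =
    (fun i => t%:num * x ord0 i + (1 - t%:num) * y ord0 i).
  by apply/funext => i; exact: convE.
exact: neg_entropy_pgf_convex.
Qed.
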